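(* Let $\alpha$ be an $R$-Cartan structure with $R>0$ on the 3-manifold $\Sigma$. Then there is only one $(I,J,1)$-generalized Finsler structure $\omega$ on $\Sigma$ that satisfies the Conformal Equivalence, the Foliation Condition and the Projective Condition, namely $$\begin{pmatrix}\omega^1\\ \omega^2\\ \omega^3\end{pmatrix}=\begin{pmatrix}m&0&0\\ -\frac{m_2}{m}+Im&\frac{m_1}{m}+Jm&-1\\ 0&m&0\end{pmatrix}\begin{pmatrix}\alpha^1\\ \alpha^2\\ \alpha^3\end{pmatrix},\qquad m=\sqrt R,$$ where $m$ is the conformal factor. Its invariants are uniquely determined by the structure function $R$: $$I=\frac12\frac{R_2}{R^{3/2}},\qquad J=-\frac12\frac{R_1}{R^{3/2}}.$$
   Context: An $R$-Cartan structure on a 3-manifold $\Sigma$ ($R$ a smooth function) is a coframing $\alpha=(\alpha^1,\alpha^2,\alpha^3)$ with $d\alpha^1=\alpha^2\wedge\alpha^3$, $d\alpha^2=-\alpha^1\wedge\alpha^3$, $d\alpha^3=R\,\alpha^1\wedge\alpha^2$. An $(I,J,1)$-generalized Finsler structure ($I,J$ smooth functions) is a coframing $\omega=(\omega^1,\omega^2,\omega^3)$ with $d\omega^1=-I\omega^1\wedge\omega^3+\omega^2\wedge\omega^3$, $d\omega^2=-\omega^1\wedge\omega^3$, $d\omega^3=\omega^1\wedge\omega^2-J\omega^1\wedge\omega^3$; $I,J$ are called its invariants. Subscripts denote directional derivatives with respect to $\alpha$: $df=f_1\alpha^1+f_2\alpha^2+f_3\alpha^3$. Conformal Equivalence: $\omega^1=m\alpha^1$,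 $\omega^3=m\alpha^2$ for a positive smooth function $m$ on $\Sigma$ (the conformal factor). Foliation Condition: the foliation $\{\omega^1=0,\omega^3=0\}$ (geodesic foliation of $\omega$) coincides with the foliation $\{\alpha^1=0,\alpha^2=0\}$ (indicatrix foliation of $\alpha$). Projective Condition: the foliation $\{\omega^1=0,\omega^2=0\}$ (indicatrix foliation of $\omega$) coincides with the foliation $\{\alpha^1=0,\alpha^3=0\}$ (geodesic foliation of $\alpha$). *)

(* Defs.v *)
From HB Require Import structures.
From mathcomp Require Import all_boot all_order all_algebra.
From mathcomp Require Import all_classical all_reals all_analysis.

Set Implicit Arguments.
Unset Strict Implicit.
Unset Printing Implicit Defensive.

Import Order.TTheory GRing.Theory Num.Theory.
Import numFieldNormedType.Exports.

Local Open Scope classical_set_scope.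
Local Open Scope ring_scope.

(* C^k and C^oo maps on a (in practice open) set U of a normed module:
   f is C^(k+1) iff it is Frechet differentiable at every point of U and all
   its directional derivatives are C^k on U. *)
Fixpoint Ck (K : realType) (V W : normedModType K) (k : nat) (U : set V)
    (f : V -> W) : Prop :=
  match k with
  | 0%N => forall x, U x -> {for x, continuous f}
  | k'.+1 => (forall x, U x -> differentiable f x) /\
             (forall v, Ck k' U (fun x => 'D_v f x))
  end.

Definition smooth_on (K : realType) (V W : normedModType K) (U : set V)
    (f : V -> W) : Prop := forall k, Ck k U f.

(* Coordinates are row vectors.  [coord_inv c] only matters on the open set
   [coord c @` dom c], where it is the inverse of [coord c]. *)
Record manifold3 (K : realType) := Manifold3 {
  space :> topologicalType;
  space_hausdorff : hausdorff_space space;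
  space_countable : @second_countable space;
  chart : Type;
  dom : chart -> set space;
  coord : chart -> space -> 'rV[K]_3;
  coord_inv : chart -> 'rV[K]_3 -> space;
  dom_open : forall c, open (dom c);
  dom_cover : forall p, exists c, dom c p;
  range_open : forall c, open (coord c @` dom c);
  coordK : forall c p, dom c p -> coord_inv c (coord c p) = p;
  coord_continuous : forall c p, dom c p -> {for p, continuous (coord c)};
  inv_continuous :
    forall c x, (coord c @` dom c) x -> {for x, continuous (coord_inv c)};
  transition_smooth : forall c c',
    smooth_on (coord c @` (dom c `&` dom c')) (coord c' \o coord_inv c) }.

Arguments chart {K} m.
Arguments dom {K m} c.
Arguments coord {K m} c.
Arguments coord_inv {K m} c.

Section Forms.
Variables (K : realType) (M : manifold3 K).

Definition chart_range (c : chart M) : set 'rV[K]_3 := coord c @` dom c.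

Definition smooth_fun (f : M -> K) : Prop :=
  forall c, smooth_on (chart_range c) (f \o coord_inv c).

Definition partial (i : 'I_3) (f : 'rV[K]_3 -> K) (x : 'rV[K]_3) : K :=
  'D_(delta_mx 0 i) f x.

(* Covector fields and 2-forms are given by their components in each chart:
   a c p is the column (a_i) with a = \sum_i a_i dx^i at p in the chart c, and
   b c p is the skew matrix (b_ij) with b = \sum_(i < j) b_ij dx^i /\ dx^j.
   Components at points outside the domain of the chart are irrelevant. *)
Notation covector_field := (chart M -> M -> 'cV[K]_3).
Notation bicovector_field := (chart M -> M -> 'M[K]_3).

Definition field_eq (T : Type) (a b : chart M -> M -> T) : Prop :=
  forall c p, dom c p -> a c p = b c p.

(* Smooth components, and the change-of-coordinates law
   a_i = \sum_j (d y_j / d x_i) a'_j; mathcomp's jacobian acts on row vectors,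
   so that its (i, j) entry is d y_j / d x_i. *)
Record one_form := OneForm {
  component :> covector_field;
  component_smooth : forall c,
    smooth_on (chart_range c) (component c \o coord_inv c);
  component_transition : forall c c' p, dom c p -> dom c' p ->
    component c p =
      jacobian (coord c' \o coord_inv c) (coord c p) *m component c' p }.

Definition fun_diff (f : M -> K) : covector_field :=
  fun c p => \col_i partial i (f \o coord_inv c) (coord c p).

Definition ext_diff (a : covector_field) : bicovector_field :=
  fun c p => \matrix_(i, j)
    (partial i (fun x => a c (coord_inv c x) j 0) (coord c p)
     - partial j (fun x => a c (coord_inv c x) i 0) (coord c p)).

(* (a /\ b)_ij = a_i b_j - a_j b_i *)
Definition wedge (a b : covector_field) : bicovector_field :=
  fun c p => a c p *m (b c p)^T - b c p *m (a c p)^T.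

(* Three 1-forms that are linearly independent at every point. *)
Record coframing := Coframing {
  coform :> 'I_3 -> one_form;
  coform_free : forall c p, dom c p ->
    row_free (\matrix_(k < 3) (coform k c p)^T) }.

End Forms.

Notation "a =~ b" := (field_eq a b) (at level 70, no associativity).
Notation "a ∧ b" := (wedge a b) (at level 40, left associativity).

(* The indices 1, 2, 3 of a coframing. *)
Notation i1 := (0 : 'I_3).
Notation i2 := (1 : 'I_3).
Notation i3 := (2%:R : 'I_3).

Section Structures.
Variables (K : realType) (M : manifold3 K).

Definition cartan_structure (R : M -> K) (a : coframing M) : Prop :=
  [/\ smooth_fun R,
      ext_diff (a i1) =~ a i2 ∧ a i3,
      ext_diff (a i2) =~ (fun c p => - (a i1 ∧ a i3) c p)
    & ext_diff (a i3) =~ (fun c p => R p *: (a i1 ∧ a i2) c p)].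

(* (I, J, 1)-generalized Finsler structures. *)
Definition finsler_structure (I J : M -> K) (w : coframing M) : Prop :=
  [/\ smooth_fun I /\ smooth_fun J,
      ext_diff (w i1) =~
        (fun c p => - (I p *: (w i1 ∧ w i3) c p) + (w i2 ∧ w i3) c p),
      ext_diff (w i2) =~ (fun c p => - (w i1 ∧ w i3) c p)
    & ext_diff (w i3) =~
        (fun c p => (w i1 ∧ w i2) c p - J p *: (w i1 ∧ w i3) c p)].

(* The vector (f_1, f_2, f_3) at p with d f = f_1 a^1 + f_2 a^2 + f_3 a^3 at p
   (it exists and is unique when f is smooth). *)
Definition dirders (a : coframing M) (f : M -> K) (p : M) : 'rV[K]_3 :=
  xget 0 [set u : 'rV[K]_3 | forall c, dom c p ->
    fun_diff f c p = \sum_(i < 3) u 0 i *: a i c p].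

Definition dirder (a : coframing M) (f : M -> K) (i : 'I_3) (p : M) : K :=
  dirders a f p 0 i.

Definition conformal_equivalence (a w : coframing M) (m : M -> K) : Prop :=
  [/\ smooth_fun m, forall p, 0 < m p,
      w i1 =~ (fun c p => m p *: a i1 c p)
    & w i3 =~ (fun c p => m p *: a i2 c p)].

(* The foliations {b = 0, b' = 0} and {e = 0, e' = 0} coincide.  A foliation
   is identified with its tangent distribution; tangent vectors are rows v of
   components in a chart, paired with covectors by v *m _. *)
Definition same_foliation (b b' e e' : chart M -> M -> 'cV[K]_3) : Prop :=
  forall c p, dom c p -> forall v : 'rV[K]_3,
    (v *m b c p = 0 /\ v *m b' c p = 0) <->
    (v *m e c p = 0 /\ v *m e' c p = 0).

Definition foliation_condition (a w : coframing M) : Prop :=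
  same_foliation (w i1) (w i3) (a i1) (a i2).

Definition projective_condition (a w : coframing M) : Prop :=
  same_foliation (w i1) (w i2) (a i1) (a i3).

End Structures.

(* Main.v *)
Require Import Defs.
From HB Require Import structures.
From mathcomp Require Import all_boot all_order all_algebra.
From mathcomp Require Import all_classical all_reals all_analysis.
From mathcomp Require Import ring.
(* A second time, so that coord denotes the charts of a manifold and not the
   coordinates in a basis of a vector space. *)
Require Import Defs.

Set Implicit Arguments.
Unset Strict Implicit.
Unset Printing Implicit Defensive.

Import Order.TTheory GRing.Theory Num.Theory.
Import numFieldNormedType.Exports.

Local Open Scope classical_set_scope.
Local Open Scope ring_scope.

(** Why the theorem holds.  Write a1, a2, a3 for the Cartan coframing and
    w1 = m a1, w3 = m a2 for the forms prescribed by the conformal condition.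

    Uniqueness.  Expand w2 in the basis (a1, a2, a3).  Comparing
    d(m a1) = dm /\ a1 + m a2 /\ a3 and d(m a2) = dm /\ a2 - m a1 /\ a3 with
    the structure equations of w forces the a3-coefficient of w2 to be -1 and
    expresses I and J by m_1, m_2 and the other two coefficients
    ([conformal_algebra]).  The projective condition says that w2 vanishes on
    the vector dual to a2, so that w2 = s a1 - a3.  The defect b = w2 + a3 is
    therefore a smooth form proportional to a1, and the equations for d w2
    and d a3 give d b = (R - m^2) a1 /\ a2.  Hence
      0 = d (b /\ a1) = d b /\ a1 - b /\ d a1 = - s a1 /\ a2 /\ a3,
    which yields s = 0 ([finsler_defect0]) without differentiating s; then b
    is 0, so d b is 0 and m^2 = R ([conformal_factor_sq]).  The invariants
    become I = m_2 / m^2 and J = - m_1 / m^2.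

    Existence.  The coframing (m a1, - a3, m a2) with m^2 = R satisfies the
    structure equations, for these I and J, if and only if m_3 = 0, that is
    R_3 = 0.  This is the
    Bianchi identity ([cartan_dirder3]), which comes from
    0 = d (d a3) = dR /\ a1 /\ a2.  With I m = m_2 / m and J m = - m_1 / m
    the displayed coefficients of a1 and a2 in w2 cancel.

    The identity d (d a) = 0 rests on the symmetry of second derivatives
    ([derive_comm]), and the smoothness of I, J and of the new coframing on
    the closure of C^k maps under the arithmetic operations and the square
    root. *)

(** * Calculus of C^k maps on an open set *)

(** Frechet differentiability is a property of germs: the differential of f
    also satisfies the o-expansion that characterizes a differential of g. *)
Lemma near_eq_differentiable (K : realType) (V W : normedModType K)
    (f g : V -> W) (x : V) :
  {near x, f =1 g} -> differentiable f x -> differentiable g x.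
Proof.
move=> fg /diff_locallyP[dfc /eqaddoP dfE].
have fgx : f x = g x := nbhs_singleton fg.
have fg0 : \forall h \near (0 : V), f (h + x) = g (h + x).
  by move: fg; rewrite (near_shift 0) subr0.
have dgE : g \o shift x = cst (g x) + 'd f x +o_ 0 id.
  apply/eqaddoP => e e0; have := dfE e e0; move: fg0.
  by apply: filterS2 => h /= fgh; rewrite !fctE /= fgh fgx.
by apply/diff_locallyP; rewrite (diff_unique dfc dgE).
Qed.

Section CkCalculus.
Variables (K : realType) (V : normedModType K).
Variable U : set V.
Hypothesis openU : open U.

Lemma near_on_open (P : V -> Prop) (x : V) :
  U x -> (forall y, U y -> P y) -> \near x, P x.
Proof.
move=> Ux UP; have Ux' : nbhs x U by exact: open_nbhs_nbhs.
exact: filterS Ux'.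
Qed.

(** Every closure property below goes through this lemma: a rule of
    differentiation gives an equality of derivatives on U only. *)
Lemma Ck_ext (W : normedModType K) k (f g : V -> W) :
  (forall x, U x -> f x = g x) -> Ck k U f -> Ck k U g.
Proof.
elim: k f g => [|k IH] f g fg /=.
  move=> fc x Ux; have := fc x Ux; rewrite /prop_for /continuous_at fg//.
  apply: cvg_trans.
  by apply: near_eq_cvg; exact: near_on_open.
move=> [df Df]; split=> [x Ux|v].
  by apply: near_eq_differentiable (df x Ux); exact: near_on_open.
apply: IH (Df v) => x Ux; apply: near_eq_derive.
by apply: near_on_open => // y; exact: fg.
Qed.

Lemma CkW (W : normedModType K) k (f : V -> W) : Ck k.+1 U f -> Ck k U f.
Proof.
elim: k f => [|k IH] f [df Df].
  by move=> x Ux; apply: differentiable_continuous; exact: df.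
by split=> // v; apply: IH.
Qed.

Lemma Ck_cst (W : normedModType K) k (w : W) : Ck k U (cst w).
Proof.
elim: k w => [|k IH] w /=; first by move=> x _; exact: cvg_cst.
split=> [x _|v]; first exact: differentiable_cst.
by apply: (Ck_ext _ (IH 0)) => x _; rewrite derive_cst.
Qed.

Lemma CkD (W : normedModType K) k (f g : V -> W) :
  Ck k U f -> Ck k U g -> Ck k U (f \+ g).
Proof.
elim: k f g => [|k IH] f g.
  by move=> fc gc x Ux; apply: cvgD; [exact: fc|exact: gc].
move=> [df Df] [dg Dg]; split=> [x Ux|v].
  by apply: differentiableD; [exact: df|exact: dg].
apply: (Ck_ext _ (IH _ _ (Df v) (Dg v))) => x Ux.
by rewrite [RHS]deriveD//; apply: diff_derivable; [exact: df|exact: dg].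
Qed.

Lemma CkM k (f g : V -> K) :
  Ck k U f -> Ck k U g -> Ck k U (fun x => f x * g x).
Proof.
elim: k f g => [|k IH] f g.
  by move=> fc gc x Ux; apply: cvgM; [exact: fc|exact: gc].
move=> Cf Cg; have [df Df] := Cf; have [dg Dg] := Cg; split=> [x Ux|v].
  by apply: differentiableM; [exact: df|exact: dg].
apply: (Ck_ext _ (CkD (IH _ _ (CkW Cf) (Dg v)) (IH _ _ (CkW Cg) (Df v)))).
move=> x Ux; rewrite [RHS]deriveM//; apply: diff_derivable.
  exact: df.
exact: dg.
Qed.

Lemma CkN k (f : V -> K) : Ck k U f -> Ck k U (fun x => - f x).
Proof.
have C1 : Ck k U (fun=> -1 : K) by exact: Ck_cst.
by move=> Cf; apply: Ck_ext (CkM C1 Cf) => x _; rewrite mulN1r.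
Qed.

(** The derivative of 1/f is a product of powers of 1/f and of the derivative
    of f, so one more order of regularity follows from the previous one. *)
Lemma CkV k (f : V -> K) : (forall x, U x -> f x != 0) ->
  Ck k U f -> Ck k U (fun x => (f x)^-1).
Proof.
move=> f0; elim: k => [|k IH] Cf.
  by move=> x Ux; apply: cvgV; [exact: f0|exact: Cf].
have [df Df] := Cf; split=> [x Ux|v].
  by apply: differentiableV; [exact: df|exact: f0].
have Ci := IH (CkW Cf).
apply: (Ck_ext _ (CkN (CkM (CkM Ci Ci) (Df v)))) => x Ux.
rewrite [RHS]deriveV; [|exact: f0|exact/diff_derivable/df].
by rewrite scaleNr /GRing.scale /= expr2 invfM.
Qed.

(** As for the inverse: the derivative of the square root of f is expressed by
    the square root itself, which is of class C^k by induction. *)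
Lemma Ck_sqrt k (f : V -> K) : (forall x, U x -> 0 < f x) ->
  Ck k U f -> Ck k U (fun x => Num.sqrt (f x)).
Proof.
move=> f0; elim: k => [|k IH] Cf.
  move=> x Ux; apply: continuous_comp; first exact: Cf.
  exact: sqrt_continuous.
have [df Df] := Cf.
have dsqrt x : U x -> differentiable Num.sqrt (f x).
  by move=> Ux; apply/derivable1_diffP; have [] := is_derive1_sqrt (f0 x Ux).
split=> [x Ux|v].
  by apply: differentiable_comp; [exact: df|exact: dsqrt].
have Ci : Ck k U (fun x => (2 * Num.sqrt (f x))^-1).
  apply: CkV => [x Ux|]; last by apply: CkM (IH (CkW Cf)); exact: Ck_cst.
  by rewrite gt_eqF// mulr_gt0// sqrtr_gt0 f0.
apply: (Ck_ext _ (CkM (Df v) Ci)) => x Ux.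
have dc : differentiable (Num.sqrt \o f) x.
  by apply: differentiable_comp; [exact: df|exact: dsqrt].
rewrite [RHS](deriveE _ dc).
(* the chain rule, with the differential of the square root at f x being
   multiplication by its derivative there *)
have E := congr1 (fun h : V -> K => h v) (diff_comp (df x Ux) (dsqrt x Ux)).
apply: (etrans _ (esym E)) => /=; rewrite -(deriveE _ (df x Ux)).
have dlin (t : K) : 'd Num.sqrt (f x) (t *: 1) = t * 'd Num.sqrt (f x) 1.
  exact: linearZ.
rewrite -[X in 'd Num.sqrt (f x) X]mulr1 dlin; congr (_ * _).
by rewrite -(deriveE _ (dsqrt x Ux)) derive_sqrt// f0.
Qed.

Lemma Ck_entry m n k (F : V -> 'M[K]_(m, n)) i j :
  Ck k U F -> Ck k U (fun x => F x i j).
Proof.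
elim: k F => [|k IH] F.
  move=> Fc x Ux; apply: (@continuous_comp _ _ _ F (fun N => N i j)).
    exact: Fc.
  exact: matrix_normedtype.coord_continuous.
move=> [dF DF]; split=> [x Ux|v].
  apply: (@differentiable_comp _ _ _ _ F (fun N => N i j)); first exact: dF.
  exact: differentiable_coord.
apply: (Ck_ext _ (IH _ (DF v))) => x Ux.
by rewrite derive_mx ?mxE//; exact/diff_derivable/dF.
Qed.

(** Regularity of a matrix-valued map can be checked on its entries; with
    [Ck_entry] this reduces tensor fields to scalar functions. *)
Lemma Ck_mx m n k (F : V -> 'M[K]_(m, n)) :
  (forall i j, Ck k U (fun x => F x i j)) -> Ck k U F.
Proof.
elim: k F => [|k IH] F CF.
  move=> x Ux; apply/cvgrPdist_le => /= e e0.
  near=> y; rewrite /Num.Def.normr/= mx_normrE (bigmax_le _ (ltW e0))//=.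
  move=> ij _; rewrite !mxE.
  move: ij; near: y; apply: filter_forall => -[i j].
  by move/cvgrPdist_le: (CF i j x Ux); apply.
have FE : F = \sum_(i < m) \sum_(j < n) (fun x => F x i j *: delta_mx i j).
  apply/funext => x; rewrite [LHS]matrix_sum_delta fct_sumE.
  by apply: eq_bigr => i _; rewrite fct_sumE.
have dF x : U x -> differentiable F x.
  move=> Ux; rewrite FE; apply: differentiable_sum => i.
  apply: differentiable_sum => j; apply: differentiableZl.
  by case: (CF i j) => + _; exact.
split=> // v; apply: IH => i j; case: (CF i j) => _ /(_ v).
by apply: Ck_ext => x Ux; rewrite derive_mx ?mxE//; exact/diff_derivable/dF.
Unshelve. all: by end_near. Qed.

End CkCalculus.

(** * Symmetry of second derivatives *)

Lemma ler_dist_half (K : realFieldType) (e a b c d : K) :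
  c = d -> `|a - d| < e / 2 -> `|b - c| < e / 2 -> `|a - b| <= e.
Proof.
move=> -> ad bd; rewrite [e]splitr -(subrKA d) (le_trans (ler_normD _ _))//.
by rewrite lerD ?[`|d - b|]distrC ?ltW.
Qed.

Section Schwarz.
Variables (K : realType) (V : normedModType K).

(** The growth rates of s |-> f (y + s u) at s are literally those of f at
    y + s u in the direction u. *)
Lemma is_derive_line (f : V -> K) (u y : V) (s : K) :
  differentiable f (y + s *: u) ->
  is_derive s 1 (fun s => f (y + s *: u)) ('D_u f (y + s *: u)).
Proof.
move=> df.
have E : (fun h : K => h^-1 *: (((fun s => f (y + s *: u)) \o shift s) (h *: 1)
           - f (y + s *: u)))
    = (fun h => h^-1 *: ((f \o shift (y + s *: u)) (h *: u)
           - f (y + s *: u))).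
  apply/funext => h /=; congr (_ *: (f _ - _)).
  by rewrite [h *: 1]mulr1 scalerDl addrCA.
by split; rewrite /derivable /derive E//; exact: diff_derivable.
Qed.

Lemma derive_translate (f : V -> K) (u w y : V) :
  'D_u (fun y => f (y + w)) y = 'D_u f (y + w).
Proof.
have E : (fun h : K => h^-1 *: (((fun y => f (y + w)) \o shift y) (h *: u)
           - f (y + w)))
    = (fun h => h^-1 *: ((f \o shift (y + w)) (h *: u) - f (y + w))).
  by apply/funext => h /=; rewrite addrA.
by rewrite /derive E.
Qed.

Lemma MVT_line (f : V -> K) (u y : V) (h : K) : 0 < h ->
  (forall s, 0 <= s <= h -> differentiable f (y + s *: u)) ->
  exists2 s, 0 <= s <= h & f (y + h *: u) - f y = 'D_u f (y + s *: u) * h.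
Proof.
move=> h0 df.
have [s||s] := @MVT K (fun s => f (y + s *: u))
    (fun s => 'D_u f (y + s *: u)) 0 h h0.
- rewrite in_itv /= => /andP[s0 sh]; apply: is_derive_line.
  by apply: df; rewrite !ltW.
- apply: derivable_within_continuous => r; rewrite in_itv /= => sh.
  by have [] := is_derive_line (df r sh).
- rewrite in_itv /= => /andP[s0 sh].
  by rewrite scale0r addr0 subr0 => E; exists s => //; rewrite !ltW.
Qed.

Variables (U : set V) (f : V -> K).
Hypothesis Cf : Ck 2 U f.

(** The mean value theorem, used in the direction u for
    y |-> f (y + h v) - f y and then in the direction v for the derivative of
    f along u.  The left-hand side is symmetric in u and v, which is what
    compares the two orders of differentiation. *)
Lemma second_difference (u v x : V) (h : K) : 0 < h ->
  (forall s t, 0 <= s <= h -> 0 <= t <= h -> U (x + s *: u + t *: v)) ->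
  exists s t, [/\ 0 <= s <= h, 0 <= t <= h &
    f (x + h *: u + h *: v) - f (x + h *: u) - (f (x + h *: v) - f x)
    = 'D_v ('D_u f) (x + s *: u + t *: v) * h * h].
Proof.
move=> h0 Uh; have [df Df] := Cf.
have hh : 0 <= h <= h by rewrite lexx ltW.
have h00 : 0 <= (0 : K) <= h by rewrite lexx ltW.
pose g := fun y => f (y + h *: v) - f y.
have dshift y : differentiable f (y + h *: v) ->
    differentiable (fun y => f (y + h *: v)) y.
  move=> dfy; apply: (@differentiable_comp _ _ _ _ (+%R^~ (h *: v)) f) => //.
have Uh0 s : 0 <= s <= h -> U (x + s *: u).
  by move=> sh; have := Uh s 0 sh h00; rewrite scale0r addr0.
have [s sh|s sh E1] := @MVT_line g u x h h0.
  apply: differentiableB; last exact/df/Uh0.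
  by apply: dshift; apply: df; exact: Uh.
have [t th|t th E2] := @MVT_line ('D_u f) v (x + s *: u) h h0.
  by have [+ _] := Df u; apply; exact: Uh.
exists s, t; split => //; rewrite -E2.
have <- : g (x + h *: u) - g x =
    f (x + h *: u + h *: v) - f (x + h *: u) - (f (x + h *: v) - f x) by [].
rewrite E1; congr (_ * _); rewrite deriveB.
- by rewrite derive_translate.
- by apply/diff_derivable/dshift/df/Uh.
- exact/diff_derivable/df/Uh0.
Qed.

(** Symmetry of second derivatives: the second difference equals h^2 times
    either mixed derivative at points close to x, so the two mixed derivatives
    take a common value arbitrarily close to x, and both are continuous. *)
Lemma derive_comm (u v x : V) : open U -> U x ->
  'D_u ('D_v f) x = 'D_v ('D_u f) x.
Proof.
move=> oU Ux; have [_ Df] := Cf.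
have cD w w' : {for x, continuous ('D_w ('D_w' f))}.
  by have [_ /(_ w)] := Df w'; apply.
apply/eqP; rewrite -subr_eq0 -normr_le0; apply/ler_addgt0Pl => e e0.
rewrite addr0; have e2 : 0 < e / 2 by rewrite divr_gt0.
have near_cD w w' : \forall y \near x,
    `|'D_w ('D_w' f) x - 'D_w ('D_w' f) y| < e / 2.
  by have /cvgrPdist_lt := cD w w'; apply.
have Un : nbhs x U by exact: open_nbhs_nbhs.
have /nbhs_normP[r /= r0 rB] : \forall y \near x,
    [/\ U y, `|'D_u ('D_v f) x - 'D_u ('D_v f) y| < e / 2
      & `|'D_v ('D_u f) x - 'D_v ('D_u f) y| < e / 2].
  by apply: filterS3 Un (near_cD u v) (near_cD v u) => y Uy uv vu; split.
(* a step h small enough for the parallelogram with sides h u and h v to stay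
   in the ball of radius r; the 1 avoids a division by 0 *)
pose n := `|u| + `|v| + 1.
have n0 : 0 < n by rewrite ltr_wpDl// addr_ge0.
pose h := r / n; have h0 : 0 < h by rewrite divr_gt0.
have B w w' s t : 0 <= s <= h -> 0 <= t <= h -> `|w| + `|w'| + 1 = n ->
    `|x - (x + s *: w + t *: w')| < r.
  move=> /andP[s0 sh] /andP[t0 th] wn.
  rewrite -addrA opprD addNKr normrN.
  apply: (le_lt_trans (ler_normD _ _)); rewrite !normrZ !ger0_norm//.
  apply: (@le_lt_trans _ _ (h * `|w| + h * `|w'|)).
    by rewrite lerD// ler_wpM2r.
  rewrite -mulrDr /h mulrAC ltr_pdivrMr// ltr_pM2l// -wn.
  by rewrite ltrDl.
have nC : `|v| + `|u| + 1 = n by rewrite /n [`|v| + _]addrC.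
have [s t|s [t [sh th E1]]] := @second_difference u v x h h0.
  by move=> sh th; have [] := rB _ (B _ _ _ _ sh th erefl).
have [s' t'|s' [t' [s'h t'h E2]]] := @second_difference v u x h h0.
  by move=> s'h t'h; have [] := rB _ (B _ _ _ _ s'h t'h nC).
have [_ _ b1] := rB _ (B u v s t sh th erefl).
have [_ b2 _] := rB _ (B v u s' t' s'h t'h nC).
have E : 'D_v ('D_u f) (x + s *: u + t *: v)
    = 'D_u ('D_v f) (x + s' *: v + t' *: u).
  apply: (mulIf (lt0r_neq0 h0)); apply: (mulIf (lt0r_neq0 h0)).
  have exch (a b c d : K) : a - b - (c - d) = a - c - (b - d) by ring.
  apply: (etrans (esym E1)); apply: (etrans _ E2).
  by rewrite exch [x + h *: u + h *: v]addrAC.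
exact: ler_dist_half E b2 b1.
Qed.

End Schwarz.

(** * Partial derivatives in a chart *)

Section ChartCalculus.
Variables (K : realType) (M : manifold3 K) (c : chart M).

Definition chart_smooth (f : M -> K) : Prop :=
  smooth_on (chart_range c) (f \o coord_inv c).

Definition chart_partial (i : 'I_3) (f : M -> K) (p : M) : K :=
  partial i (f \o coord_inv c) (coord c p).

Lemma open_chart_range : open (chart_range c).
Proof. exact: range_open. Qed.

Lemma chart_rangeP p : dom c p -> chart_range c (coord c p).
Proof. by move=> cp; exists p. Qed.

Lemma coord_invK x : chart_range c x -> coord c (coord_inv c x) = x.
Proof. by move=> [p cp <-]; rewrite coordK. Qed.

Lemma dom_coord_inv x : chart_range c x -> dom c (coord_inv c x).
Proof. by move=> [p cp <-]; rewrite coordK. Qed.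

Lemma near_chart (P : M -> Prop) p : dom c p -> (forall q, dom c q -> P q) ->
  \forall x \near coord c p, P (coord_inv c x).
Proof.
move=> cp DP; apply: (@near_on_open _ _ _ open_chart_range
  (fun x => P (coord_inv c x)) _ (chart_rangeP cp)) => x xr.
exact/DP/dom_coord_inv.
Qed.

Lemma chart_smooth_ext f g : (forall q, dom c q -> f q = g q) ->
  chart_smooth f -> chart_smooth g.
Proof.
move=> fg sf k; apply: (Ck_ext open_chart_range _ (sf k)) => x xr /=.
exact/fg/dom_coord_inv.
Qed.

Lemma chart_smoothD f g :
  chart_smooth f -> chart_smooth g -> chart_smooth (fun q => f q + g q).
Proof. by move=> sf sg k; exact: (CkD open_chart_range (sf k) (sg k)). Qed.

Lemma chart_smoothM f g :
  chart_smooth f -> chart_smooth g -> chart_smooth (fun q => f q * g q).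
Proof. by move=> sf sg k; exact: (CkM open_chart_range (sf k) (sg k)). Qed.

Lemma chart_smoothN f : chart_smooth f -> chart_smooth (fun q => - f q).
Proof. by move=> sf k; exact: (CkN open_chart_range (sf k)). Qed.

Lemma chart_smoothV f : (forall q, dom c q -> f q != 0) ->
  chart_smooth f -> chart_smooth (fun q => (f q)^-1).
Proof.
move=> f0 sf k; apply: (CkV open_chart_range _ (sf k)) => x xr.
exact/f0/dom_coord_inv.
Qed.

Lemma chart_smooth_sqrt f : (forall q, dom c q -> 0 < f q) ->
  chart_smooth f -> chart_smooth (fun q => Num.sqrt (f q)).
Proof.
move=> f0 sf k; apply: (Ck_sqrt open_chart_range _ (sf k)) => x xr.
exact/f0/dom_coord_inv.
Qed.

Lemma chart_smooth_cst (k : K) : chart_smooth (fun=> k).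
Proof. by move=> n; exact: (Ck_cst open_chart_range). Qed.

Lemma chart_smooth_partial i f :
  chart_smooth f -> chart_smooth (chart_partial i f).
Proof.
move=> sf k; have [_ Df] := sf k.+1.
apply: (Ck_ext open_chart_range _ (Df (delta_mx 0 i))) => x xr /=.
by rewrite /chart_partial coord_invK.
Qed.

Lemma chart_smooth_differentiable f p : dom c p -> chart_smooth f ->
  differentiable (f \o coord_inv c) (coord c p).
Proof. by move=> cp sf; have [df _] := sf 1%N; exact/df/chart_rangeP. Qed.

Lemma chart_smooth_derivable f p v : dom c p -> chart_smooth f ->
  derivable (f \o coord_inv c) (coord c p) v.
Proof.
by move=> cp sf; exact/diff_derivable/chart_smooth_differentiable.
Qed.

Section Partial.
Variables (p : M) (cp : dom c p).

Lemma chart_partial_ext i f g : (forall q, dom c q -> f q = g q) ->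
  chart_partial i f p = chart_partial i g p.
Proof.
move=> fg; apply: near_eq_derive.
exact: (near_chart (P := fun q => f q = g q) cp fg).
Qed.

Lemma chart_partialD i f g : chart_smooth f -> chart_smooth g ->
  chart_partial i (fun q => f q + g q) p
  = chart_partial i f p + chart_partial i g p.
Proof. by move=> sf sg; apply: deriveD; exact: chart_smooth_derivable. Qed.

Lemma chart_partialN i f : chart_smooth f ->
  chart_partial i (fun q => - f q) p = - chart_partial i f p.
Proof. by move=> sf; apply: deriveN; exact: chart_smooth_derivable. Qed.

Lemma chart_partialM i f g : chart_smooth f -> chart_smooth g ->
  chart_partial i (fun q => f q * g q) p
  = f p * chart_partial i g p + g p * chart_partial i f p.
Proof.
move=> sf sg; have := deriveM (v := delta_mx 0 i)
  (chart_smooth_derivable cp sf) (chart_smooth_derivable cp sg).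
by rewrite /= coordK.
Qed.

(** Close to p the inner partial derivative is the derivative of the local
    representative of f, to which the symmetry of second derivatives applies. *)
Lemma chart_partialC i j f : chart_smooth f ->
  chart_partial i (chart_partial j f) p = chart_partial j (chart_partial i f) p.
Proof.
move=> sf; have E k l : chart_partial k (chart_partial l f) p
    = 'D_(delta_mx 0 k) ('D_(delta_mx 0 l) (f \o coord_inv c)) (coord c p).
  apply: near_eq_derive; apply: (near_on_open open_chart_range (chart_rangeP cp)).
  by move=> x xr; rewrite /= /chart_partial coord_invK.
apply: (etrans (E i j)); apply: (etrans _ (esym (E j i))).
exact: (derive_comm (sf 2%N) _ _ open_chart_range (chart_rangeP cp)).
Qed.

End Partial.
End ChartCalculus.

Arguments open_chart_range {K M} c.

(** * Exterior calculus in coordinates *)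

(** Generalizes partial derivatives and matrix entries to variables: ring
    would otherwise compare these terms up to conversion. *)
Ltac gen_atoms := repeat match goal with
  | |- context [@chart_partial ?K ?M ?c ?i ?f ?p] =>
      move: (@chart_partial K M c i f p)
  | |- context [@fun_of_matrix ?K ?m ?n ?A ?i ?j] =>
      move: (@fun_of_matrix K m n A i j)
  end.

Section ExteriorCalculus.
Variables (K : realType) (M : manifold3 K).
Notation covector_field := (chart M -> M -> 'cV[K]_3).
Notation bicovector_field := (chart M -> M -> 'M[K]_3).
Implicit Types (a b : covector_field) (B : bicovector_field) (f : M -> K).

(** The coefficient on dx0 /\ dx1 /\ dx2 of the product of a 2-covector and a
    covector; in dimension three a 3-form is one scalar in each chart. *)
Definition wedge21 (B : 'M[K]_3) (w : 'cV[K]_3) : K :=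
  B 0 1 * w 2%:R 0 + B 1 2%:R * w 0 0 + B 2%:R 0 * w 1 0.

(** The coefficient of the exterior derivative of a 2-form. *)
Definition ext_diff2 B (c : chart M) (p : M) : K :=
  chart_partial c 0 (fun q => B c q 1 2%:R) p
  + chart_partial c 1 (fun q => B c q 2%:R 0) p
  + chart_partial c 2%:R (fun q => B c q 0 1) p.

Definition smooth_field a := forall c i, chart_smooth c (fun q => a c q i 0).
Definition smooth_field2 B := forall c i j, chart_smooth c (fun q => B c q i j).

Lemma wedgeE a b c p i j :
  (a ∧ b) c p i j = a c p i 0 * b c p j 0 - b c p i 0 * a c p j 0.
Proof. by rewrite !mxE !big_ord1 !mxE. Qed.

Lemma ext_diffE a c p i j : ext_diff a c p i j =
  chart_partial c i (fun q => a c q j 0) p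
  - chart_partial c j (fun q => a c q i 0) p.
Proof. by rewrite mxE. Qed.

Lemma fun_diffE f c p i : fun_diff f c p i 0 = chart_partial c i f p.
Proof. by rewrite mxE. Qed.

Lemma ext_diff_ext a b : a =~ b -> ext_diff a =~ ext_diff b.
Proof.
move=> ab c p cp; apply/matrixP => i j; rewrite !ext_diffE.
by congr (_ - _); apply: chart_partial_ext => // q cq; rewrite ab.
Qed.

Lemma ext_diff2_ext B B' c p : dom c p -> B =~ B' ->
  ext_diff2 B c p = ext_diff2 B' c p.
Proof.
move=> cp BB'; congr (_ + _ + _);
by apply: chart_partial_ext => // q cq; rewrite BB'.
Qed.

Lemma ext_diffD a b : smooth_field a -> smooth_field b ->
  ext_diff (fun c p => a c p + b c p)
  =~ (fun c p => ext_diff a c p + ext_diff b c p).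
Proof.
move=> sa sb c p cp; apply/matrixP => i j; rewrite [RHS]mxE !ext_diffE.
have E k l : chart_partial c k (fun q => (a c q + b c q) l 0) p
    = chart_partial c k (fun q => a c q l 0) p
      + chart_partial c k (fun q => b c q l 0) p.
  by rewrite -chart_partialD//; apply: chart_partial_ext => // q; rewrite mxE.
by rewrite !E opprD addrACA.
Qed.

Lemma ext_diffZ f a : smooth_fun f -> smooth_field a ->
  ext_diff (fun c p => f p *: a c p)
  =~ (fun c p => (fun_diff f ∧ a) c p + f p *: ext_diff a c p).
Proof.
move=> sf sa c p cp; apply/matrixP => i j.
rewrite [RHS]mxE [X in _ = _ + X]mxE wedgeE !ext_diffE !fun_diffE.
have E k l : chart_partial c k (fun q => (f q *: a c q) l 0) p
    = f p * chart_partial c k (fun q => a c q l 0) p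
      + a c p l 0 * chart_partial c k f p.
  rewrite -(chart_partialM cp _ (sf c) (sa c l)).
  by apply: chart_partial_ext => // q; rewrite mxE.
by rewrite !E; gen_atoms => *; ring.
Qed.

Lemma ext_diff2_wedge a b c p : dom c p -> smooth_field a -> smooth_field b ->
  ext_diff2 (a ∧ b) c p
  = wedge21 (ext_diff a c p) (b c p) - wedge21 (ext_diff b c p) (a c p).
Proof.
move=> cp sa sb.
have E k i j : chart_partial c k (fun q => (a ∧ b) c q i j) p
   = a c p i 0 * chart_partial c k (fun q => b c q j 0) p
     + b c p j 0 * chart_partial c k (fun q => a c q i 0) p
     - (b c p i 0 * chart_partial c k (fun q => a c q j 0) p
     + a c p j 0 * chart_partial c k (fun q => b c q i 0) p).
  rewrite -(chart_partialM cp _ (sa c i) (sb c j)).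
  rewrite -(chart_partialM cp _ (sb c i) (sa c j)) -chart_partialN//; last first.
    exact: chart_smoothM.
  rewrite -chart_partialD//; last 2 first.
  - exact: chart_smoothM.
  - exact/chart_smoothN/chart_smoothM.
  by apply: chart_partial_ext => // q _; rewrite wedgeE.
by rewrite /ext_diff2 /wedge21 !E !ext_diffE; gen_atoms => *; ring.
Qed.

Lemma ext_diff2Z f B c p : dom c p -> smooth_fun f -> smooth_field2 B ->
  ext_diff2 (fun c p => f p *: B c p) c p
  = wedge21 (B c p) (fun_diff f c p) + f p * ext_diff2 B c p.
Proof.
move=> cp sf sB.
have E k i j : chart_partial c k (fun q => (f q *: B c q) i j) p
   = f p * chart_partial c k (fun q => B c q i j) p
     + B c p i j * chart_partial c k f p.
  rewrite -(chart_partialM cp _ (sf c) (sB c i j)).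
  by apply: chart_partial_ext => // q _; rewrite mxE.
by rewrite /ext_diff2 /wedge21 !E !fun_diffE; gen_atoms => *; ring.
Qed.

Lemma ext_diff2_0 c p : ext_diff2 (fun _ _ => 0) c p = 0.
Proof.
have E k i j : chart_partial c k (fun q => (0 : 'M[K]_3) i j) p = 0.
  by apply: (derive_cst ((0 : 'M[K]_3) i j)).
by rewrite /ext_diff2 !E !addr0.
Qed.

(** The identity d (d a) = 0: the second derivatives of each component cancel
    in pairs by symmetry. *)
Lemma ext_diff2_ext_diff a c p : dom c p -> smooth_field a ->
  ext_diff2 (ext_diff a) c p = 0.
Proof.
move=> cp sa.
have E k i j : chart_partial c k (fun q => ext_diff a c q i j) p
    = chart_partial c k (chart_partial c i (fun q => a c q j 0)) p
      - chart_partial c k (chart_partial c j (fun q => a c q i 0)) p.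
  rewrite -chart_partialN//; last exact: chart_smooth_partial.
  rewrite -chart_partialD//; last 2 first.
  - exact: chart_smooth_partial.
  - exact/chart_smoothN/chart_smooth_partial.
  by apply: chart_partial_ext => // q _; rewrite ext_diffE.
have C i k l := chart_partialC cp k l (sa c i).
rewrite /ext_diff2 !E (C 2%:R 1 0) (C 1 2%:R 0) (C 0 2%:R 1); gen_atoms => *; ring.
Qed.

End ExteriorCalculus.

(** * Linear algebra of covectors in dimension three *)

Lemma ord3P (i : 'I_3) : [\/ i = 0, i = 1 | i = 2%:R].
Proof.
case: i => [[|[|[|//]]] i3].
- by constructor 1; apply: val_inj.
- by constructor 2; apply: val_inj.
- by constructor 3; apply: val_inj.
Qed.

Lemma sum_ord3 (V : zmodType) (F : 'I_3 -> V) :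
  \sum_(i < 3) F i = F 0 + F 1 + F 2%:R.
Proof.
rewrite !big_ord_recr big_ord0 /= add0r.
by congr (F _ + F _ + F _); apply: val_inj.
Qed.

Section Covectors.
Variable K : realType.
Implicit Types (x y z d w v : 'cV[K]_3) (B : 'M[K]_3).

(** The value of [wedge] at one point, entry by entry, so that identities
    between covectors become polynomial identities between entries. *)
Definition wedge11 x y : 'M[K]_3 :=
  \matrix_(i, j) (x i 0 * y j 0 - y i 0 * x j 0).

Definition vol x y z : K := wedge21 (wedge11 x y) z.

Ltac expand := rewrite /vol /wedge21 !mxE; gen_atoms => *; ring.

Lemma det_coframe (w : 'I_3 -> 'cV[K]_3) :
  \det (\matrix_(k < 3) (w k)^T) = vol (w 0) (w 1) (w 2%:R).
Proof.
have det2 (A : 'M[K]_2) : \det A = A 0 0 * A 1 1 - A 0 1 * A 1 0.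
  rewrite (expand_det_row _ 0) big_ord_recr big_ord1 /cofactor !det_mx11 !mxE /=.
  rewrite expr0 expr1 mul1r mulN1r mulrN.
  by congr (A _ _ * A _ _ - A _ _ * A _ _); apply: val_inj.
have l00 : lift (0 : 'I_3) (0 : 'I_2) = 1 by apply: val_inj.
have l01 : lift (0 : 'I_3) (1 : 'I_2) = 2%:R by apply: val_inj.
have l10 : lift (1 : 'I_3) (0 : 'I_2) = 0 by apply: val_inj.
have l11 : lift (1 : 'I_3) (1 : 'I_2) = 2%:R by apply: val_inj.
have l20 : lift (2%:R : 'I_3) (0 : 'I_2) = 0 by apply: val_inj.
have l21 : lift (2%:R : 'I_3) (1 : 'I_2) = 1 by apply: val_inj.
rewrite (expand_det_row _ 0) sum_ord3 /cofactor !det2 /vol /wedge21 !mxE.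
rewrite !(l00, l01, l10, l11, l20, l21) /= expr0 expr1 expr2.
by gen_atoms => *; ring.
Qed.

(** Cramer's rule; its explicit quotients are what makes the directional
    derivatives along a coframing smooth. *)
Lemma cramer x y z v : vol x y z != 0 ->
  v = (vol v y z / vol x y z) *: x + (vol x v z / vol x y z) *: y
      + (vol x y v / vol x y z) *: z.
Proof.
move=> D0; apply: (scalerI D0); rewrite !scalerDr !scalerA !mulrA.
rewrite ![vol x y z * _]mulrC !mulfK//; apply/colP => i.
by have [->|->|->] := ord3P i; expand.
Qed.

Lemma vol_comb x y z (s t r : K) : let v := s *: x + t *: y + r *: z in
  [/\ vol v y z = s * vol x y z, vol x v z = t * vol x y z
    & vol x y v = r * vol x y z].
Proof. by split; expand. Qed.

(** Contraction of a volume form identifies 2-covectors with vectors.  For B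
    the product of independent covectors x and z the vector spans their common kernel,
    which is the form in which the projective condition is used. *)
Lemma annihilator B : exists r : 'rV[K]_3,
  forall v, r *m v = (wedge21 B v)%:M.
Proof.
exists (\row_i [:: B 1 2%:R; B 2%:R 0; B 0 1]`_i) => v.
by apply/matrixP => i j; rewrite !ord1 !mxE sum_ord3 !mxE /wedge21 /=; gen_atoms => *; ring.
Qed.

(** The content at one point of the structure equations of w1 = m x and
    w3 = m y, where d stands for the differential of m and (x, y, z) for the
    Cartan coframing: the products of the two equations with x and z give the
    coefficients of w. *)
Lemma conformal_algebra x y z d w (m I J u1 u2 u3 : K) :
  vol x y z != 0 -> m != 0 -> d = u1 *: x + u2 *: y + u3 *: z ->
  wedge11 d x + m *: wedge11 y z
    = - (I *: wedge11 (m *: x) (m *: y)) + wedge11 w (m *: y) ->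
  wedge11 d y + m *: - wedge11 x z
    = wedge11 (m *: x) w - J *: wedge11 (m *: x) (m *: y) ->
  vol w x z = 0 ->
  exists s, [/\ w = s *: x - z, J * m ^+ 2 = - u1 & I * m ^+ 2 = u2 + m * s].
Proof.
move=> D0 m0 -> e1 e3 wxz.
set D := vol x y z in D0.
have := cramer w D0; rewrite -/D.
move: (_ / _) (_ / _) (_ / _) => r t s wE; exists s.
(* t is the value of w on the vector dual to y *)
have t0 : t = 0.
  apply: (mulIf D0); rewrite mul0r -[RHS]oppr0 -wxz wE /D; expand.
(* the y /\ z coefficient of the first equation *)
have r1 : r = - 1.
  apply: (mulIf m0); apply: (mulIf D0); apply/eqP; rewrite -subr_eq0; apply/eqP.
  move/eqP: e1; rewrite -subr_eq0 => /eqP/(congr1 (fun B => wedge21 B x)) => e1.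
  apply: etrans (etrans e1 _); rewrite ?wE /D; expand.
move: wE e1 e3; rewrite t0 r1 scale0r addr0 scaleN1r => -> e1 e3; split=> //.
(* the x /\ y coefficients of the two equations *)
- apply: (mulIf D0).
  move/eqP: e3; rewrite -subr_eq0 => /eqP/(congr1 (fun B => wedge21 B z)) => e3.
  apply/eqP; rewrite -subr_eq0; apply/eqP.
  apply: etrans (etrans e3 _); rewrite /D; expand.
- apply: (mulIf D0).
  move/eqP: e1; rewrite -subr_eq0 => /eqP/(congr1 (fun B => wedge21 B z)) => e1.
  apply/eqP; rewrite -subr_eq0; apply/eqP.
  apply: etrans (etrans e1 _); rewrite /D; expand.
Qed.

End Covectors.

(** * Directional derivatives along a coframing *)

Section Fields.
Variables (K : realType) (M : manifold3 K).

Lemma wedge_at (a b : chart M -> M -> 'cV[K]_3) c p :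
  (a ∧ b) c p = wedge11 (a c p) (b c p).
Proof. by apply/matrixP => i j; rewrite wedgeE mxE. Qed.

Lemma smooth_one_form (a : one_form M) : smooth_field a.
Proof.
move=> c i k; have Ca := component_smooth a c k.
exact: (Ck_entry (open_chart_range c) i 0 Ca).
Qed.

Lemma smooth_component (a : chart M -> M -> 'cV[K]_3) : smooth_field a ->
  forall c, smooth_on (chart_range c) (a c \o coord_inv c).
Proof.
move=> sa c k; apply: (Ck_mx (open_chart_range c)) => i j.
by rewrite (ord1 j); exact: sa.
Qed.

Section Transition.
Variables (c c' : chart M) (p : M).
Hypotheses (cp : dom c p) (cp' : dom c' p).

(** The chain rule for f read in the chart c' and the change of coordinates;
    it makes the expansion of df in a coframing independent of the chart. *)
Lemma fun_diff_transition (f : M -> K) : smooth_fun f ->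
  fun_diff f c p =
    jacobian (coord c' \o coord_inv c) (coord c p) *m fun_diff f c' p.
Proof.
move=> sf; apply/colP => i.
set G := coord c' \o coord_inv c; set F := f \o coord_inv c'.
have GE : G (coord c p) = coord c' p by rewrite /G /= coordK.
have dG : differentiable G (coord c p).
  have [dG _] := transition_smooth c c' 1%N.
  by apply: dG; exists p.
have dF : differentiable F (G (coord c p)).
  by rewrite GE; exact: chart_smooth_differentiable cp' (sf c').
have fFG : \forall x \near coord c p, (f \o coord_inv c) x = (F \o G) x.
  have cc' : \forall x \near coord c p, dom c' (coord_inv c x).
    have := inv_continuous (chart_rangeP cp); apply.
    by rewrite coordK//; apply: open_nbhs_nbhs; split => //; exact: dom_open.
  by apply: filterS cc' => x c'x; rewrite /F /G /= coordK.
have E : fun_diff f c p i 0 = 'D_(delta_mx 0 i) (F \o G) (coord c p).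
  by rewrite mxE; exact: near_eq_derive fFG.
apply: (etrans E); rewrite (deriveE _ (differentiable_comp dG dF)).
have E2 := congr1 (fun h : 'rV[K]_3 -> K => h (delta_mx 0 i)) (diff_comp dG dF).
apply: (etrans E2) => /=.
rewrite [X in 'd F _ X]row_sum_delta linear_sum mxE; apply: eq_bigr => j _.
have dlin (t : K) : 'd F (G (coord c p)) (t *: delta_mx 0 j)
    = t * 'd F (G (coord c p)) (delta_mx 0 j) by exact: linearZ.
rewrite dlin /jacobian !mxE; congr (_ * _).
by rewrite -(deriveE _ dF) GE.
Qed.

End Transition.

Section Coframe.
Variable a : coframing M.

Lemma vol_coframe c p : dom c p -> vol (a i1 c p) (a i2 c p) (a i3 c p) != 0.
Proof.
move=> cp; have := coform_free a cp.
by rewrite row_free_unit unitmxE det_coframe unitfE.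
Qed.

(** Cramer's rule gives the expansion in one chart; as df and the coframing
    have the same transition law, the coefficients serve in every chart, so
    the choice made by [dirders] is among actual solutions. *)
Lemma fun_diff_dirders (f : M -> K) c p : smooth_fun f -> dom c p ->
  fun_diff f c p = dirder a f i1 p *: a i1 c p + dirder a f i2 p *: a i2 c p
                   + dirder a f i3 p *: a i3 c p.
Proof.
move=> sf cp.
transitivity (\sum_(i < 3) dirder a f i p *: a i c p); last by rewrite sum_ord3.
rewrite /dirder /dirders.
set S := [set u | _]; suff /(xgetPex 0) : exists u, S u by apply.
have := cramer (fun_diff f c p) (vol_coframe cp).
move: (_ / _) (_ / _) (_ / _) => t s r E.
exists (\row_i [:: r; s; t]`_i) => c' cp'.
rewrite (fun_diff_transition cp' cp sf) E sum_ord3 !mxE /=.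
rewrite !mulmxDr -!scalemxAr.
by rewrite -!(component_transition (a _) cp' cp).
Qed.

Lemma dirder_eq (f : M -> K) c p (s t r : K) : smooth_fun f -> dom c p ->
  fun_diff f c p = s *: a i1 c p + t *: a i2 c p + r *: a i3 c p ->
  [/\ dirder a f i1 p = s, dirder a f i2 p = t & dirder a f i3 p = r].
Proof.
move=> sf cp E; have D0 := vol_coframe cp.
have [] := vol_comb (a i1 c p) (a i2 c p) (a i3 c p) s t r.
rewrite -E (fun_diff_dirders sf cp).
have [-> -> ->] := vol_comb (a i1 c p) (a i2 c p) (a i3 c p)
  (dirder a f i1 p) (dirder a f i2 p) (dirder a f i3 p).
by split; apply: (mulIf D0).
Qed.

Lemma smooth_vol (u v w : chart M -> M -> 'cV[K]_3) c :
  smooth_field u -> smooth_field v -> smooth_field w ->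
  chart_smooth c (fun q => vol (u c q) (v c q) (w c q)).
Proof.
move=> su sv sw.
have S i j k : chart_smooth c (fun q => wedge11 (u c q) (v c q) i j * w c q k 0).
  apply: chart_smoothM => //.
  apply: (@chart_smooth_ext _ _ _
    (fun q => u c q i 0 * v c q j 0 + - (v c q i 0 * u c q j 0))).
    by move=> q _; rewrite mxE.
  apply: chart_smoothD; first exact: chart_smoothM.
  exact/chart_smoothN/chart_smoothM.
by apply: chart_smoothD => //; exact: chart_smoothD.
Qed.

Lemma smooth_fun_diff (f : M -> K) : smooth_fun f -> smooth_field (fun_diff f).
Proof.
move=> sf c i; apply: (chart_smooth_ext _ (chart_smooth_partial i (sf c))).
by move=> q _; rewrite fun_diffE.
Qed.

Lemma smooth_dirder (f : M -> K) i : smooth_fun f -> smooth_fun (dirder a f i).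
Proof.
move=> sf c; have sa k := smooth_one_form (a k); have sd := smooth_fun_diff sf.
have sV : chart_smooth c (fun q => (vol (a i1 c q) (a i2 c q) (a i3 c q))^-1).
  by apply: chart_smoothV => [q|]; [exact: vol_coframe|exact: smooth_vol].
have E q : dom c q ->
    [/\ vol (fun_diff f c q) (a i2 c q) (a i3 c q)
        * (vol (a i1 c q) (a i2 c q) (a i3 c q))^-1 = dirder a f i1 q,
      vol (a i1 c q) (fun_diff f c q) (a i3 c q)
        * (vol (a i1 c q) (a i2 c q) (a i3 c q))^-1 = dirder a f i2 q
    & vol (a i1 c q) (a i2 c q) (fun_diff f c q)
        * (vol (a i1 c q) (a i2 c q) (a i3 c q))^-1 = dirder a f i3 q].
  move=> cq; have D0 := vol_coframe cq; rewrite (fun_diff_dirders sf cq).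
  have [-> -> ->] := vol_comb (a i1 c q) (a i2 c q) (a i3 c q)
    (dirder a f i1 q) (dirder a f i2 q) (dirder a f i3 q).
  by rewrite !mulfK.
have [->|->|->] := ord3P i.
- apply: (chart_smooth_ext _ (chart_smoothM (smooth_vol c sd (sa i2) (sa i3)) sV)).
  by move=> q /E[].
- apply: (chart_smooth_ext _ (chart_smoothM (smooth_vol c (sa i1) sd (sa i3)) sV)).
  by move=> q /E[].
- apply: (chart_smooth_ext _ (chart_smoothM (smooth_vol c (sa i1) (sa i2) sd) sV)).
  by move=> q /E[].
Qed.

(** The Bianchi identity.  In 0 = d (d a3) = d (R a1 /\ a2) the form a1 /\ a2
    is closed by the first two structure equations, so that dR /\ a1 /\ a2
    vanishes. *)
Lemma cartan_dirder3 (R : M -> K) p : cartan_structure R a ->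
  dirder a R i3 p = 0.
Proof.
move=> [sR d1 d2 d3]; have [c cp] := dom_cover p.
have sa k := smooth_one_form (a k); have D0 := vol_coframe cp.
have : ext_diff2 (ext_diff (a i3)) c p = 0 by exact: ext_diff2_ext_diff.
rewrite (ext_diff2_ext cp d3) ext_diff2Z//; last first.
  move=> c' i j.
  apply: (@chart_smooth_ext _ _ _
    (fun q => a i1 c' q i 0 * a i2 c' q j 0 + - (a i2 c' q i 0 * a i1 c' q j 0))).
    by move=> q _; rewrite wedgeE.
  apply: chart_smoothD; first exact: chart_smoothM (sa _ _ _) (sa _ _ _).
  exact/chart_smoothN/(chart_smoothM (sa _ _ _) (sa _ _ _)).
rewrite ext_diff2_wedge// d1// d2// !wedge_at (fun_diff_dirders sR cp).
have -> : wedge21 (wedge11 (a i2 c p) (a i3 c p)) (a i2 c p)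
    - wedge21 (- wedge11 (a i1 c p) (a i3 c p)) (a i1 c p) = 0.
  by rewrite /wedge21 !mxE; gen_atoms => *; ring.
rewrite mulr0 addr0 -/(vol _ _ _).
have [_ _ ->] := vol_comb (a i1 c p) (a i2 c p) (a i3 c p)
  (dirder a R i1 p) (dirder a R i2 p) (dirder a R i3 p).
by move/eqP; rewrite mulf_eq0 (negPf D0) orbF => /eqP.
Qed.

End Coframe.
End Fields.

(** * The candidate coframing and its invariants *)

Section Cartan.
Variables (K : realType) (M : manifold3 K).

Lemma scale_form_transition (f : M -> K) (a : one_form M) c c' p :
  dom c p -> dom c' p ->
  f p *: a c p =
    jacobian (coord c' \o coord_inv c) (coord c p) *m (f p *: a c' p).
Proof.
by move=> cp cp'; rewrite -scalemxAr -(component_transition a cp cp').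
Qed.

Lemma smooth_scale (f : M -> K) (a : chart M -> M -> 'cV[K]_3) :
  smooth_fun f -> smooth_field a -> smooth_field (fun c p => f p *: a c p).
Proof.
move=> sf sa c i; apply: (chart_smooth_ext _ (chart_smoothM (sf c) (sa c i))).
by move=> q _; rewrite mxE.
Qed.

Definition scale_form (f : M -> K) (sf : smooth_fun f) (a : one_form M) :
  one_form M :=
  OneForm (smooth_component (smooth_scale sf (@smooth_one_form K M a)))
    (@scale_form_transition f a).

Lemma smooth_cst (k : K) : smooth_fun (fun _ : M => k).
Proof. by move=> c; exact: chart_smooth_cst. Qed.

(** The coefficients of the second form are those that the uniqueness argument
    forces. *)
Definition finsler_coform (m : M -> K) (sm : smooth_fun m) (a : coframing M)
    (i : 'I_3) : one_form M :=
  if i == i1 then scale_form sm (a i1)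
  else if i == i2 then scale_form (smooth_cst (- 1)) (a i3)
  else scale_form sm (a i2).

Lemma finsler_coform_free (m : M -> K) (sm : smooth_fun m) (a : coframing M) :
  (forall p, 0 < m p) -> forall c p, dom c p ->
  row_free (\matrix_(k < 3) (finsler_coform sm a k c p)^T).
Proof.
move=> m0 c p cp; rewrite row_free_unit unitmxE det_coframe unitfE.
have -> : vol (finsler_coform sm a i1 c p) (finsler_coform sm a i2 c p)
    (finsler_coform sm a i3 c p)
    = m p * m p * vol (a i1 c p) (a i2 c p) (a i3 c p).
  by rewrite /vol /wedge21 !mxE; gen_atoms => *; ring.
by rewrite !mulf_neq0 ?vol_coframe// gt_eqF.
Qed.

Definition finsler_coframing (m : M -> K) (sm : smooth_fun m)
    (m0 : forall p, 0 < m p) (a : coframing M) : coframing M :=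
  Coframing (finsler_coform_free sm a m0).

Variables (R : M -> K) (a : coframing M).
Hypothesis Ra : cartan_structure R a.
Hypothesis R0 : forall p, 0 < R p.

Let m p := Num.sqrt (R p).

Lemma sqrtR_gt0 p : 0 < m p.
Proof. by rewrite sqrtr_gt0. Qed.

Lemma sqrtR_sq p : m p * m p = R p.
Proof. by rewrite -expr2 sqr_sqrtr// ltW. Qed.

Lemma smooth_R : smooth_fun R. Proof. by case: Ra. Qed.

Lemma smooth_sqrtR : smooth_fun m.
Proof.
by move=> c; apply: chart_smooth_sqrt => [q _ //|]; exact: (smooth_R c).
Qed.

(** Differentiate m * m = R. *)
Lemma dirder_sqrtR p i : dirder a R i p = 2 * m p * dirder a m i p.
Proof.
have [c cp] := dom_cover p.
suff [E1 E2 E3] : [/\ dirder a R i1 p = 2 * m p * dirder a m i1 p,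
    dirder a R i2 p = 2 * m p * dirder a m i2 p
  & dirder a R i3 p = 2 * m p * dirder a m i3 p] by have [->|->|->] := ord3P i.
apply: (dirder_eq smooth_R cp).
rewrite -!scalerA -!scalerDr -(fun_diff_dirders a smooth_sqrtR cp).
rewrite scalerA; apply/colP => k; rewrite [RHS]mxE !fun_diffE.
have -> : chart_partial c k R p = chart_partial c k (fun q => m q * m q) p.
  by apply: chart_partial_ext => // q _; rewrite sqrtR_sq.
rewrite chart_partialM//; [ring|exact: smooth_sqrtR|exact: smooth_sqrtR].
Qed.

Lemma powR_three_half p : R p `^ (3 / 2) = R p * m p.
Proof.
have -> : (3 / 2 : K) = 1 + 2^-1 by field.
rewrite powRD; last by rewrite gt_eqF// implybT.
by rewrite powRr1 ?ltW// powR12_sqrt ?ltW.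
Qed.

(** As R^(3/2) = R m and R_i = 2 m m_i, the invariants are multiples of
    m_i / m^2, the form in which they meet the structure equations. *)
Lemma invariantE k p i :
  k * (dirder a R i p / (R p `^ (3 / 2))) = k * 2 * dirder a m i p / R p.
Proof.
rewrite powR_three_half dirder_sqrtR.
have := lt0r_neq0 (sqrtR_gt0 p); have := lt0r_neq0 (R0 p).
by move=> Rn mn; field; rewrite Rn mn.
Qed.

Lemma smooth_dirder_sqrtR i (k : K) :
  smooth_fun (fun p => k * (dirder a R i p / (R p `^ (3 / 2)))).
Proof.
move=> c; apply: (chart_smooth_ext
  (f := fun p => k * 2 * dirder a m i p * (R p)^-1)).
  by move=> q _; rewrite invariantE.
apply: chart_smoothM; last first.
  by apply: chart_smoothV => [q _|]; [rewrite gt_eqF|exact: (smooth_R c)].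
apply: chart_smoothM; first exact: chart_smooth_cst.
exact: (smooth_dirder a i smooth_sqrtR c).
Qed.

End Cartan.

(** * Existence of the Finsler structure *)

Section Existence.
Variables (K : realType) (M : manifold3 K) (R m I J : M -> K) (a : coframing M).
Hypotheses (Ra : cartan_structure R a) (sm : smooth_fun m).
Hypotheses (m0 : forall p, 0 < m p) (m3 : forall p, dirder a m i3 p = 0).
Hypothesis mR : forall p, m p * m p = R p.
Hypotheses (sI : smooth_fun I) (sJ : smooth_fun J).
Hypothesis mI : forall p, dirder a m i2 p = I p * (m p * m p).
Hypothesis mJ : forall p, dirder a m i1 p = - (J p * (m p * m p)).

Let w := finsler_coframing sm m0 a.

Lemma finsler_coframingE c p :
  [/\ w i1 c p = m p *: a i1 c p, w i2 c p = - a i3 c p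
    & w i3 c p = m p *: a i2 c p].
Proof. by split => //; rewrite -scaleN1r. Qed.

Lemma finsler_coframing_structure : finsler_structure I J w.
Proof.
have [_ d1 d2 d3] := Ra; split=> // c p cp;
  have [w1 w2 w3] := finsler_coframingE c p; cbv beta;
  rewrite !wedge_at ?w1 ?w2 ?w3.
- have E := ext_diffZ sm (@smooth_one_form K M (a i1)) cp.
  apply: (etrans E); rewrite d1// !wedge_at (fun_diff_dirders a sm cp) m3 mI.
  by apply/matrixP => i j; rewrite !mxE; gen_atoms => *; ring.
- have E := ext_diffZ (@smooth_cst K M (- 1)) (@smooth_one_form K M (a i3)) cp.
  apply: (etrans E); rewrite d3// !wedge_at -mR.
  have -> : fun_diff (fun _ : M => -1) c p = 0 :> 'cV[K]_3.
    by apply/colP => i; rewrite fun_diffE [RHS]mxE; exact: derive_cst.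
  by apply/matrixP => i j; rewrite !mxE; gen_atoms => *; ring.
- have E := ext_diffZ sm (@smooth_one_form K M (a i2)) cp.
  apply: (etrans E); rewrite d2// !wedge_at (fun_diff_dirders a sm cp) m3 mJ.
  by apply/matrixP => i j; rewrite !mxE; gen_atoms => *; ring.
Qed.

Lemma finsler_coframing_conformal : conformal_equivalence a w m.
Proof. by split. Qed.

Lemma finsler_coframing_foliation : foliation_condition a w.
Proof.
move=> c p cp v; have [-> _ ->] := finsler_coframingE c p.
have mn := lt0r_neq0 (m0 p); rewrite -!scalemxAr.
by split=> -[/eqP + /eqP]; rewrite ?scaler_eq0 ?(negPf mn) /= => /eqP-> /eqP->;
  rewrite ?scaler0.
Qed.

Lemma finsler_coframing_projective : projective_condition a w.
Proof.
move=> c p cp v; have [-> -> _] := finsler_coframingE c p.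
have mn := lt0r_neq0 (m0 p); rewrite -!scalemxAr mulmxN.
by split=> -[/eqP + /eqP]; rewrite ?scaler_eq0 ?oppr_eq0 ?(negPf mn) /= => /eqP-> /eqP->;
  rewrite ?scaler0 ?oppr0.
Qed.

End Existence.

(** * Uniqueness of the Finsler structure *)

Section Uniqueness.
Variables (K : realType) (M : manifold3 K) (R : M -> K) (a w : coframing M).
Variables (I J m : M -> K).
Hypotheses (Ra : cartan_structure R a) (Fw : finsler_structure I J w).
Hypotheses (conf : conformal_equivalence a w m) (proj : projective_condition a w).

(** The structure equations of w1 and w3 and the projective condition, brought
    to one point: the smooth form w2 + a3 is proportional to a1. *)
Lemma finsler_form2 c p : dom c p ->
  exists s, [/\ w i2 c p + a i3 c p = s *: a i1 c p,
    J p * m p ^+ 2 = - dirder a m i1 p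
  & I p * m p ^+ 2 = dirder a m i2 p + m p * s].
Proof.
move=> cp; have [_ d1 d2 d3] := Ra; have [_ e1 e2 e3] := Fw.
have [sm m0 w1 w3] := conf; have D0 := vol_coframe a cp.
have wxz : vol (w i2 c p) (a i1 c p) (a i3 c p) = 0.
  (* r spans the common kernel of a1 and a3 *)
  have [r rE] := annihilator (wedge11 (a i1 c p) (a i3 c p)).
  have [_ []] := proj cp r.
    rewrite !rE; split; apply/matrixP => i j; rewrite !mxE /wedge21 !mxE;
    gen_atoms => *; ring.
  move=> _; rewrite rE => /matrixP/(_ 0 0); rewrite !mxE eqxx mulr1n.
  move=> e; apply: etrans e; rewrite /vol /wedge21 !mxE; gen_atoms => *; ring.
have dE := fun_diff_dirders a sm cp.
have {}e1 : wedge11 (fun_diff m c p) (a i1 c p)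
    + m p *: wedge11 (a i2 c p) (a i3 c p)
    = - (I p *: wedge11 (m p *: a i1 c p) (m p *: a i2 c p))
      + wedge11 (w i2 c p) (m p *: a i2 c p).
  have := e1 c p cp; rewrite (ext_diff_ext w1 cp) !wedge_at w1// w3// => <-.
  have E := ext_diffZ sm (@smooth_one_form K M (a i1)) cp.
  by apply: etrans (esym E); rewrite d1// !wedge_at.
have {}e3 : wedge11 (fun_diff m c p) (a i2 c p)
    + m p *: - wedge11 (a i1 c p) (a i3 c p)
    = wedge11 (m p *: a i1 c p) (w i2 c p)
      - J p *: wedge11 (m p *: a i1 c p) (m p *: a i2 c p).
  have := e3 c p cp; rewrite (ext_diff_ext w3 cp) !wedge_at w1// w3// => <-.
  have E := ext_diffZ sm (@smooth_one_form K M (a i2)) cp.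
  by apply: etrans (esym E); rewrite d2// !wedge_at.
have [s [sE JE IE]] := conformal_algebra D0 (lt0r_neq0 (m0 p)) dE e1 e3 wxz.
by exists s; split=> //; rewrite sE subrK.
Qed.

Let b : chart M -> M -> 'cV[K]_3 := fun c p => w i2 c p + a i3 c p.

(** The second structure equation of w and the third one of a. *)
Lemma ext_diff_finsler_defect c p : dom c p ->
  ext_diff b c p = (R p - m p ^+ 2) *: wedge11 (a i1 c p) (a i2 c p).
Proof.
move=> cp; have [_ _ _ d3] := Ra; have [_ _ e2 _] := Fw.
have [_ _ w1 w3] := conf.
have E := ext_diffD (@smooth_one_form K M (w i2)) (@smooth_one_form K M (a i3)) cp.
apply: (etrans E); rewrite e2// d3// !wedge_at w1// w3//.
by apply/matrixP => i j; rewrite !mxE; gen_atoms => *; ring.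
Qed.

(** As b is proportional to a1, the 2-form b /\ a1 is 0.  In its vanishing
    derivative, d b /\ a1 is 0 because d b is a multiple of a1 /\ a2, so that
    b /\ d a1 = s a1 /\ a2 /\ a3 is 0 as well.  This needs no derivative of the
    coefficient s. *)
Lemma finsler_defect0 c p : dom c p -> b c p = 0.
Proof.
move=> cp; have [_ d1 _ _] := Ra; have D0 := vol_coframe a cp.
have sb : smooth_field b.
  move=> c' i; have S := chart_smoothD (@smooth_one_form K M (w i2) c' i)
    (@smooth_one_form K M (a i3) c' i).
  by apply: chart_smooth_ext S => q _; rewrite mxE.
have ba : b ∧ a i1 =~ (fun _ _ => 0).
  move=> c' q cq; have [s [bs _ _]] := finsler_form2 cq.
  by rewrite wedge_at /b bs; apply/matrixP => i j; rewrite !mxE; gen_atoms => *; ring.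
have := ext_diff2_wedge cp sb (@smooth_one_form K M (a i1)).
rewrite (ext_diff2_ext cp ba) ext_diff2_0 ext_diff_finsler_defect// d1// wedge_at.
rewrite /b; have [s [-> _ _]] := finsler_form2 cp => E.
suff -> : s = 0 by rewrite scale0r.
apply: (mulIf D0); rewrite mul0r -[RHS]oppr0 E.
by rewrite /vol /wedge21 !mxE; gen_atoms => *; ring.
Qed.

(** Once b is 0, so is d b = (R - m^2) a1 /\ a2. *)
Lemma conformal_factor_sq p : m p ^+ 2 = R p.
Proof.
have [c cp] := dom_cover p; have D0 := vol_coframe a cp.
have b0 : b =~ (fun _ _ => 0) by move=> c' q; exact: finsler_defect0.
have Z : ext_diff (fun _ _ => 0 : 'cV[K]_3) c p = 0.
  have E k : chart_partial c k (fun q => (0 : 'cV[K]_3) k 0) p = 0.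
    by exact: (derive_cst ((0 : 'cV[K]_3) k 0)).
  by apply/matrixP => i j; rewrite ext_diffE !(derive_cst, mxE) subrr.
have := ext_diff_finsler_defect cp; rewrite (ext_diff_ext b0 cp) Z.
move/(congr1 (fun B => wedge21 B (a i3 c p))) => E.
apply/eqP; rewrite eq_sym -subr_eq0; apply/eqP.
apply: (mulIf D0); rewrite mul0r; apply: etrans (etrans (esym E) _).
  by rewrite /vol /wedge21 !mxE; gen_atoms => *; ring.
by rewrite /wedge21 !mxE; gen_atoms => *; ring.
Qed.

Lemma finsler_invariants p :
  J p * m p ^+ 2 = - dirder a m i1 p /\ I p * m p ^+ 2 = dirder a m i2 p.
Proof.
have [c cp] := dom_cover p; have D0 := vol_coframe a cp.
have [s [bs -> ->]] := finsler_form2 cp; split=> //.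
suff -> : s = 0 by rewrite mulr0 addr0.
have := finsler_defect0 cp; rewrite /b bs => /eqP.
rewrite scaler_eq0 => /orP[/eqP //|/eqP a0].
by move: D0; rewrite a0 /vol /wedge21 !mxE !(mul0r, mulr0, subrr, addr0) eqxx.
Qed.

End Uniqueness.

(** * The theorem *)

Theorem proposition3p4 (K : realType) (M : manifold3 K) (R : M -> K)
    (a : coframing M) (Ra : cartan_structure R a)
    (R_gt0 : forall p, 0 < R p) :
  let m := fun p => Num.sqrt (R p) in
  let I := fun p => 1 / 2 * (dirder a R i2 p / (R p `^ (3 / 2))) in
  let J := fun p => - (1 / 2) * (dirder a R i1 p / (R p `^ (3 / 2))) in
  exists w : coframing M,
    [/\ finsler_structure I J w,
        conformal_equivalence a w m,
        foliation_condition a w,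
        projective_condition a w
      & [/\ w i1 =~ (fun c p => m p *: a i1 c p),
            w i2 =~ (fun c p =>
               (- (dirder a m i2 p / m p) + I p * m p) *: a i1 c p
               + (dirder a m i1 p / m p + J p * m p) *: a i2 c p
               - a i3 c p)
          & w i3 =~ (fun c p => m p *: a i2 c p)]]
    /\ (forall (w' : coframing M) (I' J' m' : M -> K),
          finsler_structure I' J' w' ->
          conformal_equivalence a w' m' ->
          foliation_condition a w' ->
          projective_condition a w' ->
          [/\ forall i : 'I_3, w' i =~ w i,
              forall p, I' p = I p,
              forall p, J' p = J p
            & forall p, m' p = m p]).
Proof.
move=> m I J.
have m0 p : 0 < m p by exact: sqrtR_gt0.
have mR p : m p * m p = R p by exact: sqrtR_sq.
have mn p : m p != 0 by exact: lt0r_neq0.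
have sm : smooth_fun m := smooth_sqrtR Ra R_gt0.
(* 0 = R_3 = 2 m m_3 *)
have m3 p : dirder a m i3 p = 0.
  have := dirder_sqrtR Ra R_gt0 p i3; rewrite (cartan_dirder3 p Ra) => /eqP.
  by rewrite eq_sym !mulf_eq0 pnatr_eq0 /= (negPf (mn p)) => /eqP.
have IE p : I p = dirder a m i2 p / (m p * m p).
  by rewrite /I (invariantE Ra R_gt0) mR -/m; field; rewrite gt_eqF.
have JE p : J p = - (dirder a m i1 p / (m p * m p)).
  by rewrite /J (invariantE Ra R_gt0) mR -/m; field; rewrite gt_eqF.
have sI : smooth_fun I by exact: smooth_dirder_sqrtR.
have sJ : smooth_fun J by exact: smooth_dirder_sqrtR.
have mI p : dirder a m i2 p = I p * (m p * m p).
  by rewrite IE divfK// mulf_neq0.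
have mJ p : dirder a m i1 p = - (J p * (m p * m p)).
  by rewrite JE mulNr opprK divfK// mulf_neq0.
have wE := finsler_coframingE a sm m0.
exists (finsler_coframing sm m0 a); split.
  split.
  - exact: (finsler_coframing_structure Ra).
  - exact: finsler_coframing_conformal.
  - exact: finsler_coframing_foliation.
  - exact: finsler_coframing_projective.
  - split=> c p cp; have [w1 w2 w3] := wE c p; [exact: w1| |exact: w3].
    rewrite w2 IE JE.
    have -> : - (dirder a m i2 p / m p) + dirder a m i2 p / (m p * m p) * m p = 0.
      by field; exact: mn.
    have -> : dirder a m i1 p / m p + - (dirder a m i1 p / (m p * m p)) * m p = 0.
      by field; exact: mn.
    by rewrite !scale0r !add0r.
move=> w' I' J' m' Fw' conf' _ proj'.
have [_ m'0 w'1 w'3] := conf'.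
have m'E : m' = m.
  apply/funext => p; rewrite /m -(conformal_factor_sq Ra Fw' conf' proj').
  by rewrite sqrtr_sqr gtr0_norm.
have inv p := finsler_invariants Ra Fw' conf' proj' p.
split=> [i c p cp|p|p|p]; last by rewrite m'E.
- have [w1 w2 w3] := wE c p; have [->|->|->] := ord3P i.
  + by rewrite w'1// w1 m'E.
  + rewrite w2; apply/eqP; rewrite -addr_eq0; apply/eqP.
    exact: (finsler_defect0 Ra Fw' conf' proj' cp).
  + by rewrite w'3// w3 m'E.
- have [_ E] := inv p; apply: (mulIf (mulf_neq0 (mn p) (mn p))).
  by rewrite -mI -expr2 -m'E.
- have [E _] := inv p; apply: (mulIf (mulf_neq0 (mn p) (mn p))).
  by rewrite -[RHS]opprK -mJ -expr2 -m'E.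
Qed.
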